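(* Let $\mathbb{X}=(X,\mathcal{M},\mu)$ be a nontrivial semifinite measure space with a collection of generators $\mathscr{G}$. Then: (1) $\mathrm{BMO}_{\mathscr{G}}(\mathbb{X})$ has the weak Helson-Szegő property (WHSP) if and only if it has the weak John-Nirenberg property (WJNP); (2) $\mathrm{BMO}_{\mathscr{G}}(\mathbb{X})$ has the strong Helson-Szegő property (SHSP) if and only if it has the John-Nirenberg property (JNP).
   Context: Setting: $\mathbb{X}=(X,\mathcal{M},\mu)$ is a nontrivial (i.e. $\mu(X)>0$) semifinite measure space, $\mathcal{M}^*=\{E\in\mathcal{M}:0<\mu(E)<\infty\}$, and the collection of generators $\mathscr{G}\subset\mathcal{M}^*$ covers $X$. $L^1_{\mathrm{loc}}(\mathbb{X},\mathscr{G})$ is the space of measurable $f:X\to\mathbb{R}$ with $\int_G|f|\,d\mu<\infty$ for every $G\in\mathscr{G}$; $f_G=\frac1{\mu(G)}\int_G f\,d\mu$. $\mathrm{BMO}_{\mathscr{G}}(\mathbb{X})$ is the set of $f\in L^1_{\mathrm{loc}}(\mathbb{X},\mathscr{G})$ with $\|f\|_{\mathrm{BMO}}=\sup_{G\in\mathscr{G}}\frac1{\mu(G)}\int_G|f-f_G|\,d\mu<\infty$. For $G\in\mathscr{G}$ let $\mu_f(t,G)=\mu(\{x\in G:|f(x)-f_G|>t\})/\mu(G)$. Below, conditions in which $\|f\|_{\mathrm{BMO}}$ appears in a denominator are required only for $f$ with $\|f\|_{\mathrm{BMO}}\neq0$. WJNP: there exists $c>0$ such that for every $f\in\mathrm{BMO}_{\mathscr{G}}(\mathbb{X})$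 there is $C_f>0$ with $\mu_f(t,G)\le C_f\exp(-ct/\|f\|_{\mathrm{BMO}})$ for every $G\in\mathscr{G}$ and $t>0$. JNP: there exist $c_1,c_2>0$ such that for every $f\in\mathrm{BMO}_{\mathscr{G}}(\mathbb{X})$, $\mu_f(t,G)\le c_1\exp(-c_2t/\|f\|_{\mathrm{BMO}})$ for every $G\in\mathscr{G}$ and $t>0$. A nonnegative measurable function $w$ is in $A_2(\mathbb{X},\mathscr{G})$ if $\sup_{G\in\mathscr{G}}\left(\frac1{\mu(G)}\int_G w\,d\mu\right)\left(\frac1{\mu(G)}\int_G w^{-1}\,d\mu\right)<\infty$; $f\in\log A_2(\mathbb{X},\mathscr{G})$ means $e^f\in A_2(\mathbb{X},\mathscr{G})$. For $\alpha>0$ and $\|f\|_{\mathrm{BMO}}\ne0$, $[f]_\alpha=\sup_{G\in\mathscr{G}}\frac1{\mu(G)}\int_G\exp\left(\frac{\alpha}{\|f\|_{\mathrm{BMO}}}|f-f_G|\right)d\mu$. WHSP: there exists $c_0>0$ such that for every $f\in\mathrm{BMO}_{\mathscr{G}}(\mathbb{X})$, $\frac{\alpha}{\|f\|_{\mathrm{BMO}}}f\in\log A_2(\mathbb{X},\mathscr{G})$ for every $\alpha\in(0,c_0)$. SHSP: the WHSP holds with some constant $c_0>0$, and for every $\alpha\in(0,c_0)$ there is a constant $C_\alpha>0$ with $[f]_\alpha\le C_\alpha$ for every $f\in\mathrm{BMO}_{\mathscr{G}}(\mathbb{X})$. *)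

(* Defs.v *)
From HB Require Import structures.
From mathcomp Require Import all_boot all_order all_algebra.
From mathcomp Require Import all_classical all_reals all_analysis.

Set Implicit Arguments.
Unset Strict Implicit.
Unset Printing Implicit Defensive.

Import Order.TTheory GRing.Theory Num.Theory.
Import numFieldNormedType.Exports.

Local Open Scope classical_set_scope.
Local Open Scope ring_scope.
Local Open Scope ereal_scope.

Section BMO.
Context (d : measure_display) (T : measurableType d) (R : realType).
Context (mu : {measure set T -> \bar R}).
Implicit Types (GG : set (set T)) (G : set T) (f w : T -> R).

Definition semifinite : Prop :=
  forall A, measurable A -> mu A = +oo ->
    exists B, [/\ measurable B, B `<=` A & 0 < mu B < +oo].

Definition finite_pos_sets : set (set T) :=
  [set E | measurable E /\ 0 < mu E < +oo].

Definition generators GG : Prop :=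
  GG `<=` finite_pos_sets /\ \bigcup_(G in GG) G = setT.

(* The mean value of g over G, meant for 0 < mu G < +oo. *)
Definition avg G (g : T -> \bar R) : \bar R :=
  (mu G)^-1 * \int[mu]_(x in G) g x.

(* f_G; the integral is a finite number when f is integrable on G. *)
Definition mean f G : R := fine (avg G (EFin \o f)).

Definition L1loc GG : set (T -> R) :=
  [set f : T -> R | measurable_fun setT f /\
           forall G, GG G -> \int[mu]_(x in G) `|f x|%:E < +oo].

Definition bmo_norm GG f : \bar R :=
  ereal_sup [set avg G (fun x => `|(f x - mean f G)%R|%:E) | G in GG].

Definition BMO GG : set (T -> R) :=
  [set f : T -> R | L1loc GG f /\ bmo_norm GG f < +oo].

(* ||f||_BMO as a real number, for f in BMO. *)
Definition bmo_normr GG f : R := fine (bmo_norm GG f).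

(* mu_f(t, G) *)
Definition mean_distr f (t : R) G : \bar R :=
  mu [set x | G x /\ (t < `|f x - mean f G|)%R] / mu G.

Definition WJNP GG : Prop :=
  exists2 c : R, (0 < c)%R &
    forall f, BMO GG f -> bmo_norm GG f != 0 ->
      exists2 Cf : R, (0 < Cf)%R &
        forall G (t : R), GG G -> (0 < t)%R ->
          mean_distr f t G <= (Cf * expR (- (c * t / bmo_normr GG f)))%R%:E.

Definition JNP GG : Prop :=
  exists c1 c2 : R, [/\ (0 < c1)%R, (0 < c2)%R &
    forall f, BMO GG f -> bmo_norm GG f != 0 ->
      forall G (t : R), GG G -> (0 < t)%R ->
        mean_distr f t G <= (c1 * expR (- (c2 * t / bmo_normr GG f)))%R%:E].

(* The inverse of w is taken in the extended reals, where 0^-1 = +oo. *)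
Definition A2 GG : set (T -> R) :=
  [set w : T -> R | [/\ measurable_fun setT w, forall x, (0 <= w x)%R &
    ereal_sup [set avg G (fun x => (w x)%:E) *
                   avg G (fun x => (w x)%:E^-1) | G in GG] < +oo]].

Definition logA2 GG : set (T -> R) :=
  [set f : T -> R | A2 GG (fun x => expR (f x))].

(* [f]_alpha, meant for a nonzero finite bmo_norm GG f. *)
Definition exp_osc GG (alpha : R) f : \bar R :=
  ereal_sup [set avg G
    (fun x => (expR (alpha / bmo_normr GG f * `|f x - mean f G|)%R)%:E)
    | G in GG].

Definition WHSP_with GG (c0 : R) : Prop :=
  forall f, BMO GG f -> bmo_norm GG f != 0 ->
    forall alpha : R, (0 < alpha < c0)%R ->
      logA2 GG (fun x => alpha / bmo_normr GG f * f x)%R.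

Definition WHSP GG : Prop := exists2 c0 : R, (0 < c0)%R & WHSP_with GG c0.

Definition SHSP GG : Prop :=
  exists c0 : R, [/\ (0 < c0)%R, WHSP_with GG c0 &
    forall alpha : R, (0 < alpha < c0)%R ->
      exists2 Calpha : R, (0 < Calpha)%R &
        forall f, BMO GG f -> bmo_norm GG f != 0 ->
          exp_osc GG alpha f <= Calpha%:E].

End BMO.

(* Main.v *)
Require Import Defs.
From mathcomp Require Import all_boot all_order all_algebra.
From mathcomp Require Import all_classical all_reals all_analysis.
From mathcomp Require Import measurable_realfun ring.

(** Both equivalences rest on one fact: an exponential tail of the oscillation
    |f - f_G| over G amounts to a bounded exponential moment of it, and each
    constant can be computed from the other.

    From tails to moments, |f - f_G| / ||f|| is cut into unit layers: the
    exponential of a value y is dominated by a constant plus the sum over k of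
    exp (a (k + 3)) on {y > k + 1}.  If the tail decays like C exp (- c t)
    with a < c, the averages of the layers are dominated by a geometric
    series, so the moment is at most [exp_moment_bound a c C]
    ([avg_expR_tail_le]).  This bound depends on f only through C, which
    is what separates the strong properties from the weak ones.  From moments
    to tails, Chebyshev's inequality suffices ([mean_distr_le]).

    It remains to relate moments to the A_2 condition for exp (b f).  The
    product of the averages of exp (b f) and exp (- b f) is unchanged when f is
    replaced by f - f_G, because the two constant factors cancel
    ([avg_expR_inv_center]).  Each of the two centered averages is at most the
    moment of |f - f_G|, so a bounded moment gives A_2 ([avg_expR_inv_le]).
    Conversely, Jensen's inequality makes each of them at least 1
    ([avg_expR_ge1]), so a bound on the product bounds both, hence also their
    sum, which dominates the moment ([avg_expR_osc_le]). *)

Set Implicit Arguments.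
Unset Strict Implicit.
Unset Printing Implicit Defensive.

Import Order.TTheory GRing.Theory Num.Theory.

Local Open Scope classical_set_scope.
Local Open Scope ring_scope.
Local Open Scope ereal_scope.

(** * Exponentials and geometric series *)

(** The factor [expR (2 * a)] bounds the values below 2; the quotient is the
    sum of the powers of [expR (a - c)] from the first one on, one for each
    higher unit layer. *)
Definition exp_moment_bound (R : realType) (a c C : R) : R :=
  (expR (2 * a) * (1 + C * (expR (a - c) / (1 - expR (a - c)))))%R.

Lemma exp_moment_bound_gt0 (R : realType) (a c C : R) :
  (a < c)%R -> (0 <= C)%R -> (0 < exp_moment_bound a c C)%R.
Proof.
move=> ac C0; rewrite mulr_gt0 ?expR_gt0// ltr_wpDr//.
rewrite mulr_ge0// divr_ge0 ?expR_ge0//.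
by rewrite subr_ge0 expR_le1 subr_le0 ltW.
Qed.

(** The layers start at height 1, not 0, so that tail estimates are called on
    only at positive heights. *)
Lemma expRM_le_layers (R : realType) (a y : R) : (0 <= a)%R ->
  (expR (a * y))%:E <= (expR (2 * a))%:E +
    \sum_(0 <= k <oo) (expR (a * k.+3%:R) * (k.+1%:R < y)%R%:R)%:E.
Proof.
move=> a0.
have layer0 k : 0 <= (expR (a * k.+3%:R) * (k.+1%:R < y)%R%:R)%:E.
  by rewrite lee_fin mulr_ge0 ?expR_ge0.
have [y2|y2] := ltP y 2%R.
  rewrite -[leLHS]adde0 leeD ?nneseries_ge0// lee_fin ler_expR mulrC.
  by rewrite ler_wpM2r// ltW.
have y0 : (0 <= y)%R by apply: le_trans y2.
have /andP[ny yn] := truncn_itv y0.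
(* With k + 2 the integer part of y, the single layer of index k suffices:
   k + 1 < y < k + 3. *)
have : (2 <= Num.truncn y)%N by rewrite truncn_ge_nat.
case: (Num.truncn y) ny yn => [//|[//|k]] ky yk _.
rewrite -[leLHS]add0e leeD// ?lee_fin ?expR_ge0//.
apply: (@le_trans _ _ (expR (a * k.+3%:R) * (k.+1%:R < y)%R%:R)%:E).
  rewrite (lt_le_trans _ ky) ?ltr_nat// mulr1 lee_fin ler_expR ler_wpM2l//.
  exact: ltW.
apply: le_trans (nneseries_lim_ge k.+1 _) => //.
by rewrite big_nat_recr//= leeDr// sume_ge0.
Qed.

Lemma nneseries_geometric_le (R : realType) (C q : R) :
  (0 <= C)%R -> (0 < q < 1)%R ->
  \sum_(0 <= k <oo) (C * q ^+ k)%:E <= (C / (1 - q))%:E.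
Proof.
move=> C0 /andP[q0 q1]; apply: lime_le.
  apply: is_cvg_nneseries => n _ _; rewrite lee_fin mulr_ge0// exprn_ge0//.
  exact: ltW.
apply: nearW => n; rewrite sumEFin lee_fin.
by apply: geometric_le_lim; rewrite // ger0_norm// ltW.
Qed.

Lemma ereal_lty_posbound (R : realType) (x : \bar R) :
  x < +oo -> exists2 K : R, (0 < K)%R & x <= K%:E.
Proof.
case: x => [s| |]// _; last by exists 1%R; rewrite ?leNye.
exists (Num.max 1 s)%R; first by rewrite lt_max ltr01.
by rewrite lee_fin le_max lexx orbT.
Qed.

(** * Averages over a set of finite positive measure *)

Section Average.
Context (d : measure_display) (T : measurableType d) (R : realType).
Context (mu : {measure set T -> \bar R}) (G : set T).
Hypothesis finG : finite_pos_sets mu G.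

Let mG : measurable G. Proof. by case: finG. Qed.
Let muG0 : 0 < mu G. Proof. by case: finG => _ /andP[]. Qed.
Let muGoo : mu G < +oo. Proof. by case: finG => _ /andP[]. Qed.

Lemma muG_inv : exists2 r : R, (0 < r)%R & (mu G)^-1 = r%:E /\ mu G = (r^-1)%:E.
Proof.
have := muG0; have := muGoo; case: (mu G) => [m| |] // _; rewrite lte_fin => m0.
by exists (m^-1)%R; rewrite ?invr_gt0 // inver gt_eqF // invrK.
Qed.

Lemma avg_cst (r : R) : avg mu G (fun=> r%:E) = r%:E.
Proof.
rewrite /avg (integral_cst mu mG r%:E).
have [m m0 [-> ->]] := muG_inv; rewrite -!EFinM; congr EFin.
by rewrite mulrCA mulfV ?mulr1 // gt_eqF.
Qed.

Lemma avg_ge0 (g : T -> \bar R) :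
  (forall x, G x -> 0 <= g x) -> 0 <= avg mu G g.
Proof.
move=> g0; rewrite /avg; have [m m0 [-> _]] := muG_inv.
by apply: mule_ge0; [rewrite lee_fin ltW|exact: integral_ge0].
Qed.

Lemma avg_le (g h : T -> \bar R) : (forall x, G x -> 0 <= g x) ->
  measurable_fun G g -> measurable_fun G h ->
  (forall x, G x -> g x <= h x) -> avg mu G g <= avg mu G h.
Proof.
move=> g0 mg mh gh; rewrite /avg; have [m m0 [-> _]] := muG_inv.
by rewrite lee_pmul2l ?lte_fin//; exact: ge0_le_integral.
Qed.

Lemma avgD (g h : T -> \bar R) :
  (forall x, G x -> 0 <= g x) -> measurable_fun G g ->
  (forall x, G x -> 0 <= h x) -> measurable_fun G h ->
  avg mu G (fun x => g x + h x) = avg mu G g + avg mu G h.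
Proof.
move=> g0 mg h0 mh; rewrite /avg ge0_integralD// muleDr//.
  by have [m m0 [-> _]] := muG_inv.
by apply: ge0_adde_def; rewrite inE; exact: integral_ge0.
Qed.

Lemma avgZ (k : R) (g : T -> \bar R) : (0 <= k)%R ->
  (forall x, G x -> 0 <= g x) -> measurable_fun G g ->
  avg mu G (fun x => k%:E * g x) = k%:E * avg mu G g.
Proof. by move=> k0 g0 mg; rewrite /avg ge0_integralZl_EFin// muleCA. Qed.

Lemma avg_nneseries (g : (T -> \bar R)^nat) :
  (forall n, measurable_fun G (g n)) -> (forall n x, G x -> 0 <= g n x) ->
  avg mu G (fun x => \sum_(0 <= n <oo) g n x) =
  \sum_(0 <= n <oo) avg mu G (g n).
Proof.
move=> mg g0; rewrite /avg integral_nneseries//.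
have [m m0 [-> _]] := muG_inv; rewrite nneseriesZl// => n _.
by apply: integral_ge0 => x; exact: g0.
Qed.

Lemma avg_indic (A : set T) : measurable A ->
  avg mu G (fun x => (\1_A x)%:E) = mu [set x | G x /\ A x] / mu G.
Proof.
move=> mA; rewrite /avg integral_indic// muleC; congr (mu _ * _).
by rewrite setIC.
Qed.

(** * Exponential tails and exponential moments *)

Section Fun.
Variable g : T -> R.
Hypothesis mg : measurable_fun setT g.

Let measurable_gt (t : R) : measurable [set x | (t < g x)%R].
Proof.
have := mg measurableT (measurable_itv `]t, +oo[).
by rewrite setTI; congr (measurable _); apply/seteqP; split=> x /=;
  rewrite in_itv/= andbT.
Qed.

Lemma measurable_expRM (a : R) :
  measurable_fun G (fun x => (expR (a * g x))%:E).
Proof.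
apply: measurable_funTS; apply/measurable_EFinP.
by apply: measurableT_comp => //; exact: measurable_funM.
Qed.

Lemma chebyshev_expR (a t : R) : (0 <= a)%R ->
  mu [set x | G x /\ (t < g x)%R] / mu G
    <= (expR (- (a * t)))%:E * avg mu G (fun x => (expR (a * g x))%:E).
Proof.
move=> a0; have mexp := measurable_expRM a.
have exp0 x : G x -> 0 <= (expR (a * g x))%:E.
  by move=> _; rewrite lee_fin expR_ge0.
rewrite -(avg_indic (measurable_gt t)) -(avgZ (expR_ge0 _) exp0 mexp).
apply: avg_le => [x _| | |x _].
- by rewrite lee_fin.
- by apply: measurable_funTS; apply/measurable_EFinP; exact: measurable_indic.
- by apply: emeasurable_funM.
- rewrite -EFinM lee_fin -expRD indicE.
  case: (boolP (x \in _)); rewrite ?expR_ge0// inE /= => tg.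
  by rewrite -[leLHS]expR0 ler_expR addrC subr_ge0 ler_wpM2l// ltW.
Qed.

(** Integrating the layers termwise, the layer of index k contributes at most
    [C * expR (a * (k + 3)) * expR (- c * (k + 1))], that is
    [C * expR (2 * a)] times the power k + 1 of [expR (a - c)]. *)
Lemma avg_expR_tail_le (a c C : R) : (0 <= a < c)%R -> (0 <= C)%R ->
  (forall t, (0 < t)%R ->
     mu [set x | G x /\ (t < g x)%R] / mu G <= (C * expR (- (c * t)))%:E) ->
  avg mu G (fun x => (expR (a * g x))%:E) <= (exp_moment_bound a c C)%:E.
Proof.
move=> /andP[a0 ac] C0 tail.
pose layer k x := (expR (a * k.+3%:R) * (k.+1%:R < g x)%R%:R)%:E.
have layer0 k x : G x -> 0 <= layer k x.
  by move=> _; rewrite lee_fin mulr_ge0 ?expR_ge0.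
have layerE k : layer k = fun x => (expR (a * k.+3%:R))%:E *
    (\1_[set x | (k.+1%:R < g x)%R] x)%:E.
  apply/funext => x; rewrite /layer EFinM indicE.
  congr (_ * (nat_of_bool _)%:R%:E).
  by apply/idP/idP; rewrite inE.
have mindic k : measurable_fun G
    (fun x => (\1_[set x | (k.+1%:R < g x)%R] x : R)%:E).
  by apply: measurable_funTS; apply/measurable_EFinP; exact: measurable_indic.
have mlayer k : measurable_fun G (layer k).
  by rewrite layerE; apply: emeasurable_funM.
apply: (@le_trans _ _ (avg mu G (fun x => (expR (2 * a))%:E +
                                   \sum_(0 <= k <oo) layer k x))).
  apply: avg_le => [x _| | |x _].
  - by rewrite lee_fin expR_ge0.
  - exact: measurable_expRM.
  - apply: emeasurable_funD => //; apply: ge0_emeasurable_sum => // k x Gx _.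
    exact: layer0.
  - exact: expRM_le_layers.
rewrite avgD ?avg_cst//; last 2 first.
- by move=> x Gx; apply: nneseries_ge0 => k _ _; exact: layer0.
- by apply: ge0_emeasurable_sum => // k x Gx _; exact: layer0.
rewrite avg_nneseries// /exp_moment_bound mulrDr mulr1 EFinD leeD2l//.
set q := expR (a - c).
have q01 : (0 < q < 1)%R by rewrite expR_gt0 expR_lt1 subr_lt0.
rewrite (_ : (expR _ * _)%R = (expR (2 * a) * C * q / (1 - q))%R); last first.
  by rewrite !mulrA.
apply: le_trans (nneseries_geometric_le _ q01); last first.
  by rewrite !mulr_ge0 ?expR_ge0.
apply: lee_nneseries => [k _ _|k _].
  by apply: avg_ge0 => x; exact: layer0.
rewrite layerE avgZ ?expR_ge0// avg_indic//.
apply: (@le_trans _ _ ((expR (a * k.+3%:R))%:E *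
                       (C * expR (- (c * k.+1%:R)))%:E)).
  by rewrite lee_pmul2l ?tail// lte_fin expR_gt0.
rewrite -EFinM lee_fin /q -expRM_natl mulrCA [leRHS](_ : _ =
  C * (expR (2 * a) * expR (a - c) * expR (k%:R * (a - c))))%R; last by ring.
rewrite le_eqVlt; apply/orP; left; apply/eqP; congr (_ * _)%R.
rewrite -!expRD; congr expR; rewrite -!natr1; ring.
Qed.

End Fun.

(** * Oscillation about the mean value *)

Section Mean.
Variable f : T -> R.
Hypothesis mf : measurable_fun setT f.
Hypothesis intf : \int[mu]_(x in G) `|f x|%:E < +oo.

Let integrablef : mu.-integrable G (EFin \o f).
Proof.
apply/integrableP; split=> //; apply: measurable_funTS.
exact/measurable_EFinP.
Qed.

Lemma integral_mean : \int[mu]_(x in G) (f x)%:E = (mean mu f G)%:E * mu G.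
Proof.
rewrite /mean /avg /=; have [m m0 [-> ->]] := muG_inv.
have := integrable_fin_num mG integrablef.
case: (\int[mu]_(x in G) _) => //= r _.
by rewrite -EFinM mulrAC mulfV ?mul1r// gt_eqF.
Qed.

(** Jensen's inequality for the exponential: integrate the tangent line bound
    [1 + z <= expR z] at [z = b * (f - f_G)], whose average vanishes. *)
Lemma avg_expR_ge1 (b : R) :
  1 <= avg mu G (fun x => (expR (b * (f x - mean mu f G)))%:E).
Proof.
set m := mean mu f G.
have mexp := measurable_expRM (measurable_funB mf (measurable_cst m)) b.
suff : mu G <= \int[mu]_(x in G) (expR (b * (f x - m)))%:E.
  rewrite /avg; have [r r0 [-> ->]] := muG_inv => H.
  apply: (@le_trans _ _ (r%:E * r^-1%:E)).
    by rewrite -EFinM mulfV// gt_eqF.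
  by rewrite lee_pmul2l ?lte_fin.
have [expoo|expoo] := ltP (\int[mu]_(x in G) (expR (b * (f x - m)))%:E) +oo;
  last by apply: le_trans expoo; exact: leey.
(* If the exponential has infinite integral there is nothing to prove; if not,
   both sides of the tangent line bound are integrable. *)
have iexp : mu.-integrable G (fun x => (expR (b * (f x - m)))%:E).
  apply/integrableP; split=> //; apply: le_lt_trans expoo.
  by under eq_integral do rewrite /= ger0_norm ?expR_ge0//.
have icst : mu.-integrable G (fun=> (1 - b * m)%:E).
  apply/integrableP; split; first exact: measurable_cst.
  rewrite /= (integral_cst mu mG `|1 - b * m|%:E).
  by have [r r0 [_ ->]] := muG_inv; rewrite -EFinM ltry.
have iZ := integrableZl mG b integrablef.
have <- : \int[mu]_(x in G) ((1 - b * m)%:E + b%:E * (f x)%:E) = mu G.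
  rewrite integralD// (integral_cst mu mG (1 - b * m)%:E) integralZl//.
  rewrite integral_mean; have [r r0 [_ ->]] := muG_inv.
  by rewrite -!EFinM -EFinD; congr EFin; rewrite -/m; ring.
apply: le_integral => //; first exact: integrableD.
move=> x _; rewrite lee_fin; apply: le_trans (expR_ge1Dx _).
by rewrite -subr_ge0 [leRHS](_ : _ = 0%R)//; ring.
Qed.

Lemma avg_expR_center (b : R) :
  avg mu G (fun x => (expR (b * f x))%:E) =
  (expR (b * mean mu f G))%:E *
    avg mu G (fun x => (expR (b * (f x - mean mu f G)))%:E).
Proof.
rewrite -avgZ ?expR_ge0//; last first.
  exact: (measurable_expRM (measurable_funB mf (measurable_cst _))).
congr avg; apply/funext => x; rewrite -EFinM -expRD; congr (expR _)%:E; ring.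
Qed.

(** Subtracting a constant from f multiplies the two averages by inverse
    factors, so the A_2 product sees only the oscillation of f. *)
Lemma avg_expR_inv_center (b : R) :
  avg mu G (fun x => (expR (b * f x))%:E) *
    avg mu G (fun x => (expR (b * f x))%:E^-1) =
  avg mu G (fun x => (expR (b * (f x - mean mu f G)))%:E) *
    avg mu G (fun x => (expR (- b * (f x - mean mu f G)))%:E).
Proof.
rewrite [X in _ * X](_ : _ =
    avg mu G (fun x => (expR (- b * f x))%:E)); last first.
  congr avg; apply/funext => x.
  by rewrite inver expR_eq0 mulNr expRN.
rewrite !avg_expR_center muleACA -EFinM -expRD mulNr subrr expR0.
by rewrite mul1e.
Qed.

Let measurable_osc : measurable_fun setT (fun x => `|f x - mean mu f G|%R).
Proof. by apply: measurableT_comp => //; exact: measurable_funB. Qed.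

(** Both centered averages are at least 1, so each is at most their product;
    and [expR `|z| <= expR z + expR (- z)]. *)
Lemma avg_expR_osc_le (b K : R) : (0 <= b)%R ->
  avg mu G (fun x => (expR (b * f x))%:E) *
    avg mu G (fun x => (expR (b * f x))%:E^-1) <= K%:E ->
  avg mu G (fun x => (expR (b * `|f x - mean mu f G|))%:E) <= (2 * K)%:E.
Proof.
move=> b0; rewrite avg_expR_inv_center => ABK.
have mexp c :=
  measurable_expRM (measurable_funB mf (measurable_cst (mean mu f G))) c.
have A1 := avg_expR_ge1 b; have B1 := avg_expR_ge1 (- b).
have AK := le_trans (lee_pemulr (le_trans lee01 A1) B1) ABK.
have BK := le_trans (lee_pemull (le_trans lee01 B1) A1) ABK.
apply: (@le_trans _ _ (K%:E + K%:E)); last by rewrite -EFinD lee_fin mulr_natl.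
apply: le_trans (leeD AK BK); rewrite -avgD//.
apply: avg_le => [x _| | |x _].
- by rewrite lee_fin expR_ge0.
- exact: measurable_expRM.
- exact: emeasurable_funD.
- rewrite -EFinD lee_fin; case: ger0P => _.
    by rewrite lerDl expR_ge0.
  by rewrite mulrN -mulNr lerDr expR_ge0.
Qed.

Lemma avg_expR_inv_le (b K : R) : (0 <= b)%R ->
  avg mu G (fun x => (expR (b * `|f x - mean mu f G|))%:E) <= K%:E ->
  avg mu G (fun x => (expR (b * f x))%:E) *
    avg mu G (fun x => (expR (b * f x))%:E^-1) <= (K * K)%:E.
Proof.
move=> b0 oscK; rewrite avg_expR_inv_center EFinM.
have mexp c :=
  measurable_expRM (measurable_funB mf (measurable_cst (mean mu f G))) c.
have exp0 c x : G x -> 0 <= (expR (c * (f x - mean mu f G)))%:E.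
  by move=> _; rewrite lee_fin expR_ge0.
have avgK c : `|c|%R = b ->
    avg mu G (fun x => (expR (c * (f x - mean mu f G)))%:E) <= K%:E.
  move=> cb; apply: le_trans oscK.
  apply: avg_le => [|//| |x _]; first exact: exp0.
    exact: measurable_expRM.
  by rewrite lee_fin ler_expR -cb -normrM ler_norm.
by apply: lee_pmul; [exact: avg_ge0|exact: avg_ge0|apply: avgK..];
  rewrite ?normrN ger0_norm.
Qed.

Lemma mean_distr_le (b M t : R) : (0 <= b)%R ->
  avg mu G (fun x => (expR (b * `|f x - mean mu f G|))%:E) <= M%:E ->
  mean_distr mu f t G <= (M * expR (- (b * t)))%:E.
Proof.
move=> b0 avgM; apply: le_trans (chebyshev_expR measurable_osc t b0) _.
by rewrite (mulrC M) EFinM lee_pmul2l ?lte_fin ?expR_gt0.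
Qed.

Lemma avg_expR_osc_tail_le (a c C N : R) : (0 < N)%R ->
  (0 <= a < c)%R -> (0 <= C)%R ->
  (forall t, (0 < t)%R ->
    mean_distr mu f t G <= (C * expR (- (c * t / N)))%:E) ->
  avg mu G (fun x => (expR (a / N * `|f x - mean mu f G|))%:E)
    <= (exp_moment_bound a c C)%:E.
Proof.
move=> N0 ac C0 tail.
rewrite (_ : (fun x => _) =
    fun x => (expR (a * (`|f x - mean mu f G| / N)))%:E); last first.
  by apply/funext => x; rewrite mulrAC mulrA.
apply: avg_expR_tail_le => //; first exact: measurable_funM.
move=> t t0; rewrite (_ : [set x | _] =
    [set x | G x /\ (t * N < `|f x - mean mu f G|)%R]); last first.
  by apply/funext => x /=; rewrite ltr_pdivlMr.
apply: le_trans (tail (t * N)%R (mulr_gt0 t0 N0)) _.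
by rewrite mulrA mulfK// gt_eqF.
Qed.

End Mean.

End Average.

(** * The equivalences *)

Section Properties.
Context (d : measure_display) (T : measurableType d) (R : realType).
Context (mu : {measure set T -> \bar R}) (GG : set (set T)).
Hypothesis finGG : GG `<=` finite_pos_sets mu.

Lemma bmo_normr_gt0 (f : T -> R) (G : set T) : GG G ->
  BMO mu GG f -> bmo_norm mu GG f != 0 -> (0 < bmo_normr mu GG f)%R.
Proof.
move=> GGG [_ foo] f0; apply: fine_gt0; rewrite foo andbT lt_def f0 /=.
apply: le_trans (ereal_sup_ubound _); last by exists G.
by apply: avg_ge0 => [|x _]; [exact: finGG|rewrite lee_fin].
Qed.

(** The rate c of the tails is itself an admissible Helson-Szego constant.
    As c does not vary with f, this serves the weak property and the first
    half of the strong one. *)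
Lemma WHSP_with_tail (c : R) :
  (forall f, BMO mu GG f -> bmo_norm mu GG f != 0 ->
    exists2 Cf : R, (0 < Cf)%R & forall G (t : R), GG G -> (0 < t)%R ->
      mean_distr mu f t G <= (Cf * expR (- (c * t / bmo_normr mu GG f)))%:E) ->
  WHSP_with mu GG c.
Proof.
move=> wjn f bf f0 a /andP[a0 ac]; have [C C0 tail] := wjn f bf f0.
have [[mf lf] _] := bf; set N := bmo_normr mu GG f.
split=> [|x|]; first by apply: measurableT_comp => //; exact: measurable_funM.
  exact: expR_ge0.
apply: (@le_lt_trans _ _ (exp_moment_bound a c C * exp_moment_bound a c C)%:E);
  last exact: ltry.
apply: ge_ereal_sup => _ [G GGG <-]; have N0 := bmo_normr_gt0 GGG bf f0.
apply: avg_expR_inv_le => //; [exact: finGG|by rewrite divr_ge0// ltW|].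
apply: avg_expR_osc_tail_le => //; [exact: finGG|by rewrite ltW|exact: ltW|].
by move=> t t0; exact: tail.
Qed.

(** The A_2 bound K of the scaled function may vary with f, and K is what the
    constant of the tail inherits; the rate is half of c0 for every f. *)
Lemma WJNP_of_WHSP : WHSP mu GG -> WJNP mu GG.
Proof.
move=> [c0 c00 whs]; exists (c0 / 2)%R; first by rewrite divr_gt0.
move=> f bf f0; have [[mf lf] _] := bf.
have [|_ _ supoo] := whs f bf f0 (c0 / 2)%R.
  by rewrite divr_gt0//= ltr_pdivrMr// ltr_pMr// ltr1n.
have [K K0 supK] := ereal_lty_posbound supoo.
exists (2 * K)%R; first exact: mulr_gt0.
move=> G t GGG t0; have N0 := bmo_normr_gt0 GGG bf f0.
rewrite (mulrAC (c0 / 2)%R).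
have b0 : (0 <= c0 / 2 / bmo_normr mu GG f)%R by rewrite !divr_ge0// ltW.
apply: mean_distr_le => //; first exact: finGG.
apply: avg_expR_osc_le => //; [exact: finGG|exact: lf|].
by apply: le_trans supK; apply: ereal_sup_ubound; exists G.
Qed.

Lemma JNP_of_SHSP : SHSP mu GG -> JNP mu GG.
Proof.
move=> [c0 [c00 _ shs]].
have [|C C0 expC] := shs (c0 / 2)%R.
  by rewrite divr_gt0//= ltr_pdivrMr// ltr_pMr// ltr1n.
exists C, (c0 / 2)%R; split; rewrite ?divr_gt0// => f bf f0 G t GGG t0.
have N0 := bmo_normr_gt0 GGG bf f0; have [[mf lf] _] := bf.
rewrite (mulrAC (c0 / 2)%R).
apply: mean_distr_le => //; first exact: finGG.
  by rewrite !divr_ge0// ltW.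
by apply: le_trans (expC f bf f0); apply: ereal_sup_ubound; exists G.
Qed.

Lemma SHSP_of_JNP : JNP mu GG -> SHSP mu GG.
Proof.
move=> [C [c [C0 c0 jn]]]; exists c; split=> //.
  by apply: WHSP_with_tail => f bf f0; exists C => // G t; exact: jn.
move=> a /andP[a0 ac]; exists (exp_moment_bound a c C).
  by apply: exp_moment_bound_gt0 => //; exact: ltW.
move=> f bf f0; have [[mf lf] _] := bf.
apply: ge_ereal_sup => _ [G GGG <-]; have N0 := bmo_normr_gt0 GGG bf f0.
apply: avg_expR_osc_tail_le => //; [exact: finGG|by rewrite ltW|exact: ltW|].
by move=> t t0; exact: jn.
Qed.

End Properties.

Theorem theorem4p10 (d : measure_display) (T : measurableType d) (R : realType)
    (mu : {measure set T -> \bar R}) (GG : set (set T))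
    (mu_nontrivial : 0 < mu [set: T]) (mu_semifinite : semifinite mu)
    (GG_generators : generators mu GG) :
  (WHSP mu GG <-> WJNP mu GG) /\ (SHSP mu GG <-> JNP mu GG).
Proof.
have [finGG _] := GG_generators; split; split.
- exact: WJNP_of_WHSP.
- by move=> [c c0 wjn]; exists c => //; exact: WHSP_with_tail.
- exact: JNP_of_SHSP.
- exact: SHSP_of_JNP.
Qed.
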